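(* Let $\mathbb{K}\in\{\mathbb{R},\mathbb{C}\}$, let $f(x)=P_d(Ax)$ for some $P_d\in\mathcal{P}_d$ and invertible $A\in M_n(\mathbb{K})$. Let $h(x)=f(Rx)$ where the entries of $R\in M_n(\mathbb{K})$ are chosen uniformly and independently at random from a finite set $S\subset\mathbb{K}$, and let $\{T_{i_1\dots i_{d-2}}\}$ be the slices of $h$. If $T_{\bar1}$ is invertible, let $T_{\bar1}'=T_{\bar1}^{-1}$ and let $\lambda_1,\dots,\lambda_n$ be the eigenvalues of $T_{\bar1}'T_{\bar2}$. Then $\Pr_R[\exists\, i\neq j\in[n]\text{ with }\lambda_i=\lambda_j\text{, and }T_{\bar1}\text{ is invertible}]\le\frac{2\binom{n}{2}(d-2)}{|S|}$.
   Context: $\mathcal{P}_d$ is the set of $\sum_{i=1}^n\alpha_ix_i^d$ with all $\alpha_i\in\mathbb{K}\setminus\{0\}$. Slices: for a degree-$d$ form $g=\sum T_{i_1\dots i_d}x_{i_1}\cdots x_{i_d}$ with $(T_{i_1\dots i_d})$ symmetric, $T_{i_1\dots i_{d-2}}$ is the matrix with $(i_{d-1},i_d)$ entry $T_{i_1\dots i_d}$; $T_{\bar k}=T_{k\dots k}$.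
   Formalization: The formal theorem assumes d ≥ 3, since for d = 2 the slices T_1 and T_2 coincide, all eigenvalues equal 1 and the bound 0 fails; it also assumes n ≥ 2 so that T_2 exists, and S nonempty so that the uniform choice makes sense. *)

(* Defs.v *)
From mathcomp Require Import all_boot all_order all_algebra finmap.
From mathcomp Require Import boolp reals complex mpoly.

Set Implicit Arguments.
Unset Strict Implicit.
Unset Printing Implicit Defensive.

Import GRing.Theory Num.Theory.
Local Open Scope ring_scope.

Variant scalar_kind := RealScalars | ComplexScalars.

Definition scalars (R : realType) (k : scalar_kind) : fieldType :=
  match k with
  | RealScalars => R : fieldType
  | ComplexScalars => R[i] : fieldType
  end.

Definition to_complex (R : realType) (k : scalar_kind) : scalars R k -> R[i] :=
  match k with RealScalars => fun x => x%:C%C | ComplexScalars => fun z => z end.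

Section Forms.
Variables (K : fieldType) (n : nat).

Definition power_forms (d : nat) (P : {mpoly K[n]}) : Prop :=
  exists2 alpha : 'I_n -> K,
    forall i, alpha i != 0 & P = \sum_(i < n) alpha i *: 'X_i ^+ d.

(* The polynomial x |-> p (M x), with x a column vector. *)
Definition linear_subst (p : {mpoly K[n]}) (M : 'M[K]_n) : {mpoly K[n]} :=
  p \mPo [tuple \sum_(j < n) M i j *: 'X_j | i < n].

Definition tensor (d : nat) := d.-tuple 'I_n -> K.

Definition symmetric_tensor d (T : tensor d) : Prop :=
  forall s t : d.-tuple 'I_n, perm_eq s t -> T s = T t.

Definition form_of_tensor d (T : tensor d) : {mpoly K[n]} :=
  \sum_(t : d.-tuple 'I_n) T t *: \prod_(k < d) 'X_(tnth t k).

Definition is_tensor_of d (g : {mpoly K[n]}) (T : tensor d) : Prop :=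
  symmetric_tensor T /\ g = form_of_tensor T.

(* The cast only identifies (d - 2) + 2 with d. *)
Definition slice d (hd : (2 <= d)%N) (T : tensor d)
    (s : (d - 2).-tuple 'I_n) : 'M[K]_n :=
  \matrix_(i, j) T (tcast (subnK hd) [tuple of s ++ [:: i; j]]).

Definition diag_slice d (hd : (2 <= d)%N) (T : tensor d) (k : 'I_n) : 'M[K]_n :=
  slice hd T (nseq_tuple (d - 2) k).

End Forms.

(* Every form considered has a symmetric tensor (it is unique in characteristic
   0), so quantifying over tensors satisfying is_tensor_of is not vacuous. *)
Lemma power_form_tensor_exists (K : fieldType) n d (P : {mpoly K[n]}) (A M : 'M[K]_n) :
  power_forms d P ->
  exists T : tensor K n d, is_tensor_of (linear_subst (linear_subst P A) M) T.
Proof.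
case=> al _ ->.
exists (fun t => \sum_(i<n) al i * \prod_(k<d) (A *m M) i (tnth t k)); split.
  move=> s t st; apply: eq_bigr => i _; congr (_ * _).
  by rewrite -!(big_tuple _ _ _ xpredT (fun l => (A *m M) i l)); apply: perm_big.
rewrite /linear_subst /form_of_tensor.
pose L (B : 'M[K]_n) := [tuple \sum_(j < n) B i j *: 'X_j | i < n].
have LE B i : tnth (L B) i = \sum_(j<n) B i j *: 'X_[U_(j)] by rewrite tnth_mktuple.
have E i : ('X_i \mPo L A) \mPo L M = \sum_(l<n) (A *m M) i l *: 'X_l.
  rewrite comp_mpolyXU -tnth_nth LE linear_sum /=.
  under eq_bigr do rewrite linearZ /= comp_mpolyXU -tnth_nth LE scaler_sumr.
  rewrite exchange_big /=; apply: eq_bigr => l _; rewrite !mxE scaler_suml.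
  by apply: eq_bigr => j _; rewrite scalerA.
rewrite -/(L A) -/(L M). rewrite (raddf_sum (comp_mpoly (L A))) (raddf_sum (comp_mpoly (L M))).
rewrite /=.
under eq_bigr => i _.
  rewrite !comp_mpolyZ -/(L A) -/(L M) !rmorphXn /= E.
  rewrite -[d in _ ^+ d]card_ord -prodr_const.
  rewrite bigA_distr_bigA /= scaler_sumr.
  over.
rewrite /= exchange_big /=.
rewrite (reindex (fun t : d.-tuple 'I_n => [ffun k => tnth t k])) /=; last first.
  exists (fun f : {ffun 'I_d -> 'I_n} => [tuple f k | k < d]) => x _.
    by apply: eq_from_tnth => k; rewrite tnth_mktuple ffunE.
  by apply/ffunP => k; rewrite ffunE tnth_mktuple.
apply: eq_bigr => t _; rewrite scaler_suml; apply: eq_bigr => i _.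
rewrite -scalerA; congr (_ *: _).
under eq_bigr do rewrite ffunE.
by rewrite scaler_prod.
Qed.

(* lam lists the eigenvalues of M with algebraic multiplicity. *)
Definition eigenvalue_list (F : fieldType) (n : nat) (M : 'M[F]_n)
    (lam : 'I_n -> F) : Prop :=
  char_poly M = \prod_(i < n) ('X - (lam i)%:P).

(* For real M the eigenvalues are taken in the complex numbers. *)
Definition repeated_eigenvalue (R : realType) (k : scalar_kind) (n : nat)
    (M : 'M[scalars R k]_n) : Prop :=
  exists2 lam : 'I_n -> R[i],
    eigenvalue_list (map_mx (@to_complex R k) M) lam &
    exists i j : 'I_n, i != j /\ lam i = lam j.

(* Probability of E for a random matrix whose entries are independent and
   uniform on S: each outcome r carries the product of the weights 1 / |S| of
   its entries. *)
Definition Pr_unif (R : realType) (K : fieldType) (n : nat) (S : {fset K})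
    (E : 'M[K]_n -> Prop) : R :=
  \sum_(r : 'M[S]_n | `[< E (map_mx val r) >])
    \prod_(i < n) \prod_(j < n) (#|` S|%:R)^-1.

(* Main.v *)
Require Import Defs.
From mathcomp Require Import all_boot all_order all_algebra finmap.
From mathcomp Require Import boolp reals complex mpoly.

Set Implicit Arguments.
Unset Strict Implicit.
Unset Printing Implicit Defensive.

Import GRing.Theory Num.Theory.
Local Open Scope ring_scope.

(** With [B = A R], the slices of [h] are [B^T diag(alpha_i B_ik^(d-2)) B], so
    when [T1] is invertible [T1^-1 T2] is conjugate to the diagonal matrix with
    entries [(B_i2 / B_i1)^(d-2)]. A repeated eigenvalue thus means
    [(B_i2 B_j1)^(d-2) = (B_j2 B_i1)^(d-2)] for some [i <> j], that is,
    [B_i2 B_j1 = z B_j2 B_i1] for one of the at most [d-2] roots of unity [z].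
    Once the first column of [R] is fixed, this is a linear equation on its
    second column, nonzero because rows [i] and [j] of [A] are independent, hence
    it has probability at most [1/|S|]; the union bound over [z] and over the
    [2 'C(n, 2)] ordered pairs [(i, j)] concludes. *)

(** * Tensors and slices of sums of powers *)

Definition power_tensor (K : fieldType) (n d : nat) (alpha : 'I_n -> K)
    (B : 'M[K]_n) : tensor K n d :=
  fun t => \sum_(i < n) alpha i * \prod_(k < d) B i (tnth t k).

Lemma power_tensor_sym (K : fieldType) (n d : nat) (alpha : 'I_n -> K)
    (B : 'M[K]_n) : symmetric_tensor (@power_tensor K n d alpha B).
Proof.
move=> s t st; apply: eq_bigr => i _; congr (_ * _).
by rewrite -!(big_tuple _ _ _ xpredT (B i)); apply: perm_big.
Qed.

Lemma linear_substM (K : fieldType) (n : nat) (p : {mpoly K[n]})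
    (A M : 'M[K]_n) :
  linear_subst (linear_subst p A) M = linear_subst p (A *m M).
Proof.
pose L (B : 'M[K]_n) := [tuple \sum_(j < n) B i j *: 'X_j | i < n].
have LE B i : tnth (L B) i = \sum_(j < n) B i j *: 'X_[U_(j)].
  by rewrite tnth_mktuple.
have LM i : tnth (L A) i \mPo L M = tnth (L (A *m M)) i.
  rewrite !LE linear_sum /=.
  under eq_bigr do rewrite linearZ /= comp_mpolyXU -tnth_nth LE scaler_sumr.
  rewrite exchange_big /=; apply: eq_bigr => j _.
  by rewrite mxE scaler_suml; apply: eq_bigr => l _; rewrite scalerA.
rewrite /linear_subst -!/(L _) (comp_mpolyE p (L A)) (comp_mpolyE p (L (A *m M))).
rewrite linear_sum /=; apply: eq_bigr => m _; rewrite linearZ /= rmorph_prod /=.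
by congr (_ *: _); apply: eq_bigr => i _; rewrite rmorphXn /= LM.
Qed.

Lemma linear_subst_power_sum (K : fieldType) (n d : nat) (alpha : 'I_n -> K)
    (B : 'M[K]_n) :
  linear_subst (\sum_(i < n) alpha i *: 'X_i ^+ d) B
  = form_of_tensor (@power_tensor K n d alpha B).
Proof.
rewrite /linear_subst linear_sum /= /form_of_tensor.
under [RHS]eq_bigr do rewrite scaler_suml.
rewrite exchange_big /=; apply: eq_bigr => i _.
rewrite linearZ /= rmorphXn /= comp_mpolyXU -tnth_nth tnth_mktuple.
(* The power expands into a sum over the maps from ['I_d] to ['I_n], which are then read as
   tuples. *)
rewrite -[d in _ ^+ d]card_ord -prodr_const bigA_distr_bigA /= scaler_sumr.
rewrite (reindex (fun t : d.-tuple 'I_n => [ffun k => tnth t k])) /=.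
  apply: eq_bigr => t _; rewrite -scalerA -scaler_prod.
  by under eq_bigr do rewrite ffunE.
exists (fun f : {ffun 'I_d -> 'I_n} => [tuple f k | k < d]) => x _.
  by apply: eq_from_tnth => k; rewrite tnth_mktuple ffunE.
by apply/ffunP => k; rewrite ffunE tnth_mktuple.
Qed.

(* The coefficient of the monomial of t counts every rearrangement of t once. *)
Lemma mcoeff_form_of_tensor (K : fieldType) (n d : nat) (T : tensor K n d)
    (t : d.-tuple 'I_n) :
  symmetric_tensor T ->
  (form_of_tensor T)@_(\sum_(k < d) U_(tnth t k))%MM
  = T t *+ #|[pred s : d.-tuple 'I_n | perm_eq s t]|.
Proof.
move=> symT; pose mon (s : d.-tuple 'I_n) := (\sum_(k < d) U_(tnth s k))%MM.
have monE s i : mon s i = count_mem i s.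
  rewrite mnm_sumE -(big_tuple _ _ _ xpredT (fun j => U_(j)%MM i)) -sum1_count.
  by rewrite [RHS]big_mkcond; apply: eq_bigr => j _; rewrite mnm1E /=; case: (j == i).
have monP s : (mon s == mon t) = perm_eq s t.
  apply/eqP/idP => [E | st].
    by apply/allP => i _ /=; rewrite -!monE E.
  by apply/mnmP => i; rewrite !monE; apply/permP.
rewrite /form_of_tensor linear_sum /= -sumr_const [RHS]big_mkcond /=.
apply: eq_bigr => s _; rewrite linearZ /= mprodXE mcoeffX -/(mon s) -/(mon t).
rewrite monP inE; case: ifP => st; last by rewrite mulr0.
by rewrite mulr1; apply: symT.
Qed.

(** The coefficient at the monomial of [t] is [T t] times a positive count, [t] being a
    rearrangement of itself, and characteristic 0 lets that count be cancelled. *)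
Lemma symmetric_tensor_uniq (K : fieldType) (n d : nat) (T T' : tensor K n d) :
  has_char0 K -> symmetric_tensor T -> symmetric_tensor T' ->
  form_of_tensor T = form_of_tensor T' -> T =1 T'.
Proof.
move=> /pcharf0P K0 symT symT' E t.
have := mcoeff_form_of_tensor t symT; rewrite E mcoeff_form_of_tensor //.
move/esym/eqP; rewrite -subr_eq0 -mulrnBl -mulr_natr mulf_eq0 K0 subr_eq0.
case/orP => [/eqP // | /eqP/card0_eq/(_ t)].
by rewrite inE perm_refl.
Qed.

(** In each term the [d - 2] repeated indices give the power of [B l k]; the last two give the
    entries of [B^T] and [B]. *)
Lemma diag_slice_power_tensor (K : fieldType) (n d : nat) (hd : (2 <= d)%N)
    (alpha : 'I_n -> K) (B : 'M[K]_n) (k : 'I_n) :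
  diag_slice hd (@power_tensor K n d alpha B) k
  = B^T *m diag_mx (\row_i (alpha i * B i k ^+ (d - 2))) *m B.
Proof.
apply/matrixP => i j; rewrite mul_mx_diag !mxE /power_tensor.
apply: eq_bigr => l _; rewrite !mxE.
rewrite -(big_tuple _ _ _ xpredT (B l)) val_tcast /= big_cat /= big_nseq.
rewrite !big_cons big_nil iter_mulr_1 mulr1 -!mulrA.
by rewrite [RHS]mulrC -!mulrA; congr (_ * (_ * _)); rewrite mulrC.
Qed.

(** * Eigenvalues of the pencil *)

(** [B] also intertwines the characteristic matrices; take determinants and cancel that of [B]. *)
Lemma char_poly_intertwine (K : fieldType) (n : nat) (B N D : 'M[K]_n) :
  B \in unitmx -> B *m N = D *m B -> char_poly N = char_poly D.
Proof.
move=> uB BN; pose Bx := map_mx (@polyC K) B.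
have E : Bx *m char_poly_mx N = char_poly_mx D *m Bx.
  rewrite /char_poly_mx mulmxBr mulmxBl mul_mx_scalar mul_scalar_mx.
  by rewrite -!map_mxM /= BN.
have dB0 : \det Bx != 0.
  by rewrite det_map_mx polyC_eq0 -unitfE -unitmxE.
apply: (mulfI dB0); rewrite /char_poly -det_mulmx E det_mulmx; exact: mulrC.
Qed.

(** By unique factorization the two lists are permutations of each other. *)
Lemma eigenvalue_list_inj (F : fieldType) (n : nat) (M : 'M[F]_n)
    (lam mu : 'I_n -> F) :
  eigenvalue_list M lam -> eigenvalue_list M mu -> injective mu ->
  injective lam.
Proof.
rewrite /eigenvalue_list => -> E mu_inj.
have pe : perm_eq (codom lam) (codom mu).
  by apply: prod_XsubC_eq; rewrite !big_image.
by apply/injectiveP; rewrite /injectiveb /dinjectiveb (perm_uniq pe) map_inj_uniq ?enum_uniq.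
Qed.

(** Lets the real and complex cases share one proof. *)
Lemma to_complex_rmorphism (R : realType) (k : scalar_kind) :
  exists phi : {rmorphism scalars R k -> R[i]}, @to_complex R k =1 phi.
Proof.
case: k; first by exists (real_complex R).
by exists (@idfun R[i]).
Qed.

Lemma scalars_char0 (R : realType) (k : scalar_kind) : has_char0 (scalars R k).
Proof. by case: k; exact: pchar_num. Qed.

(* invmx T1 *m T2 is conjugate under B to the diagonal matrix of the d2 / d1. *)
Lemma pencil_repeated_eigenvalue (R : realType) (k : scalar_kind) (n : nat)
    (B : 'M[scalars R k]_n) (d1 d2 : 'rV[scalars R k]_n) :
  let T1 := B^T *m diag_mx d1 *m B in
  let T2 := B^T *m diag_mx d2 *m B in
  T1 \in unitmx -> repeated_eigenvalue (invmx T1 *m T2) ->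
  (forall i, d1 0 i != 0) /\
  exists i j : 'I_n, i != j /\ d2 0 i * d1 0 j = d2 0 j * d1 0 i.
Proof.
move=> T1 T2 uT1 [lam lamE [i [j [ij lamij]]]].
have := uT1; rewrite !unitmx_mul unitmx_tr -andbA => /and3P[uB uD1 _].
have d1_neq0 l : d1 0 l != 0.
  move: uD1; rewrite unitmxE det_diag unitfE prodf_seq_neq0 => /allP.
  by move/(_ l); rewrite mem_index_enum /=; exact.
split=> //.
pose mu l := d2 0 l / d1 0 l; set N := invmx T1 *m T2 in lamE.
have TN : T1 *m N = T2 by rewrite mulmxA mulmxV // mul1mx.
clearbody N.
have muE : eigenvalue_list N mu.
  rewrite /eigenvalue_list (@char_poly_intertwine _ _ B N (diag_mx (\row_l mu l))) //.
    rewrite char_poly_trig ?diag_mx_is_trig //.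
    by apply: eq_bigr => l _; rewrite !mxE eqxx.
  (* Multiplying on the left by the invertible [B^T *m diag_mx d1] turns the goal into
     [T1 *m N = T2]. *)
  apply: (can_inj (mulKmx uD1)); apply: (@can_inj _ _ (mulmx B^T) (mulmx (invmx B^T))).
    by apply: mulKmx; rewrite unitmx_tr.
  rewrite !mulmxA -/T1 TN /T2 -(mulmxA B^T (diag_mx d1)) mulmx_diag; congr (_ *m diag_mx _ *m _).
  by apply/rowP => l; rewrite !mxE mulrC divfK.
have [phi phiE] := to_complex_rmorphism R k.
have muE' : eigenvalue_list (map_mx (@to_complex R k) N) (phi \o mu).
  rewrite /eigenvalue_list (eq_map_mx _ phiE) -map_char_poly muE rmorph_prod /=.
  by apply: eq_bigr => l _; rewrite rmorphB /= map_polyX map_polyC.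
(* An injective [mu] would stay injective under [phi], against the repetition in [lam]. *)
have mu_noninj : ~ injective mu.
  move=> mu_inj; move/eqP: ij; apply.
  apply: (eigenvalue_list_inj lamE muE' _ lamij).
  exact: inj_comp (@fmorph_inj _ _ phi) mu_inj.
have [x [y [xy muxy]]] : exists x y, x != y /\ mu x = mu y.
  apply: contra_notP mu_noninj => H x y muxy; apply: contra_notP H => /eqP xy.
  by exists x, y.
exists x, y; split=> //.
by apply/eqP; rewrite -eqr_div //; apply/eqP.
Qed.

(** * Roots of unity and independence of rows *)

Lemma roots_seq (K : fieldType) (p : {poly K}) :
  p != 0 -> exists2 s : seq K, (size s < size p)%N &
    forall x, root p x -> x \in s.
Proof.
have [m] := ubnP (size p); elim: m p => // m IHm p.
rewrite ltnS => szp p0.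
have [[x px] | noroot] := pselect (exists x, root p x); last first.
  exists [::]; first by rewrite size_poly_gt0.
  by move=> x px; case: noroot; exists x.
have [q pE] := factor_theorem p x px.
have q0 : q != 0 by apply: contraNneq p0; rewrite pE => ->; rewrite mul0r.
have szq : size p = (size q).+1 by rewrite pE size_Mmonic ?monicXsubC // size_XsubC addn2.
have [|s szs sE] := IHm q _ q0; first by rewrite -szq.
exists (x :: s); first by rewrite /= szq ltnS.
move=> y; rewrite pE rootM root_XsubC inE => /orP[/sE -> | ->] //.
by rewrite orbT.
Qed.

(** For nonzero [y] the ratio [x / y] is a root of ['X^e - 1], which has at most [e] roots. *)
Lemma eq_expr_seq (K : fieldType) (e : nat) : (0 < e)%N ->
  exists2 s : seq K, (size s <= e)%N &
    forall x y : K, x ^+ e = y ^+ e -> exists2 z, z \in s & x = z * y.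
Proof.
move=> e0.
have [|s szs sE] := @roots_seq K ('X^e - 1); first by rewrite -size_poly_gt0 size_XnsubC.
rewrite size_XnsubC // ltnS in szs.
exists s => // x y E.
have [y0 | y_neq0] := eqVneq y 0.
  (* Here [x] vanishes too, so any element of [s] would do. *)
  exists 1; first by apply: sE; rewrite /root !hornerE expr1n subrr.
  move: E; rewrite y0 mulr0 expr0n gtn_eqF // => /eqP.
  by rewrite expf_eq0 e0 => /eqP.
exists (x / y); last by rewrite divfK.
by apply: sE; rewrite /root !hornerE expr_div_n E divff ?subrr // expf_neq0.
Qed.

(** Otherwise [A] would kill the row vector [u], whose entry at [i] is [c]. *)
Lemma unitmx_rows_indep (K : fieldType) (n : nat) (A : 'M[K]_n) (i j : 'I_n)
    (c c' : K) :
  A \in unitmx -> i != j -> c != 0 -> exists m, c * A i m != c' * A j m.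
Proof.
move=> uA ij c0; apply: contrapT => H.
pose u : 'rV[K]_n := c *: delta_mx 0 i - c' *: delta_mx 0 j.
have uA0 : u *m A = 0.
  rewrite mulmxBl -!scalemxAl -!rowE; apply/rowP => m; rewrite !mxE.
  by apply/eqP; rewrite subr_eq0; apply: contra_notT H => cm; exists m.
have : u 0 i = 0 by rewrite -[u](mulmxK uA) uA0 mul0mx mxE.
rewrite !mxE !eqxx /= (negPf ij) mulr0 subr0 mulr1 => /eqP.
by rewrite (negPf c0).
Qed.

(** * Counting matrices, with denominators cleared *)

Lemma card_union_bound (T : finType) (I : eqType) (s : seq I) (E : pred T)
    (F : I -> pred T) (c N : nat) :
  (forall x, E x -> exists2 i, i \in s & F i x) ->
  (forall i, i \in s -> #|F i| * c <= N)%N ->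
  (#|E| * c <= size s * N)%N.
Proof.
elim: s E => [|i s IHs] E EF FN.
  suff /eq_card0 -> : E =i pred0 by [].
  by move=> x; rewrite !inE; apply/negP => /EF[].
(* What [F i] misses is covered by the rest of the list. *)
pose E' := [predD E & F i].
apply: (@leq_trans ((#|F i| + #|E'|) * c)).
  rewrite leq_mul2r -(cardID (F i) E); apply/orP; right; rewrite leq_add2r.
  by apply: subset_leq_card; apply/subsetP => x /andP[].
rewrite mulnDl mulSn leq_add ?FN ?mem_head //.
apply: IHs => [x /andP[Fi /EF[l]] | l sl]; last by rewrite FN // inE sl orbT.
by rewrite inE => /orP[/eqP -> Fl | sl Fl]; [case/negP: Fi | exists l].
Qed.

(* Column p fixes a nonzero linear equation on column q. The pivot m of that
   equation depends only on column p, so overwriting entry (m, q) of a solution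
   by an arbitrary element of S can be undone. *)
Lemma card_column_relation (K : fieldType) (n : nat) (S : {fset K})
    (A : 'M[K]_n) (i j p q : 'I_n) (z : K) (E : pred 'M[S]_n) :
  A \in unitmx -> i != j -> p != q ->
  (forall r, E r -> let B := A *m map_mx val r in
     B j p != 0 /\ B j p * B i q = z * (B i p * B j q)) ->
  (#|E| * #|{: S}| <= #|{: 'M[S]_n}|)%N.
Proof.
move=> uA ij pq EP; pose B (r : 'M[S]_n) := A *m map_mx val r.
(* The default [i] is never reached on [E]: there [B r j p] is nonzero, so independence of the rows
   gives a pivot. *)
pose pivot r := odflt i [pick m | B r j p * A i m != z * B r i p * A j m].
pose Phi (x : 'M[S]_n * S) : 'M[S]_n :=
  \matrix_(a, b) if (a == pivot x.1) && (b == q) then x.2 else x.1 a b.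
rewrite -cardX; apply: (@leq_card_in _ _ Phi).
move=> [r s] [r' s'] /andP[/EP/=[rp rE] _] /andP[/EP/=[_ rE'] _].
rewrite -!/(B _) in rp rE rE'.
move/matrixP => PhiE.
have colp a : r a p = r' a p.
  by have := PhiE a p; rewrite !mxE /= (negPf pq) !andbF.
have Bp l : B r l p = B r' l p.
  by rewrite !mxE; apply: eq_bigr => a _; rewrite !mxE colp.
have piv : pivot r = pivot r' by rewrite /pivot !Bp.
set m := pivot r in piv.
have mP : B r j p * A i m != z * B r i p * A j m.
  rewrite /m /pivot; case: pickP => //= none.
  have [m' m'P] := unitmx_rows_indep (z * B r i p) uA ij rp.
  by have := none m'; rewrite m'P.
have rr' a b : (a == m) && (b == q) = false -> r a b = r' a b.
  by move=> ab; have := PhiE a b; rewrite !mxE /= -piv -/m ab.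
have ss' : s = s' by have := PhiE m q; rewrite !mxE /= -piv -/m !eqxx.
(* [r] and [r'] agree off [(m, q)], so only that entry contributes. *)
have BE l : B r l q - B r' l q = A l m * (val (r m q) - val (r' m q)).
  rewrite !mxE -sumrB (bigD1 m) //= big1 ?addr0 => [|a am]; rewrite !mxE.
    by rewrite -mulrBr.
  by rewrite rr' ?subrr // (negPf am).
(* Subtract the relations for [r] and [r']; the first factor is nonzero by choice of the pivot. *)
have : (B r j p * A i m - z * B r i p * A j m) * (val (r m q) - val (r' m q)) = 0.
  rewrite mulrBl -!mulrA -!BE !mulrBr rE mulrA [in B r j p * B r' i q]Bp rE' !Bp.
  by rewrite !mulrA subrr.
move/eqP; rewrite mulf_eq0 !subr_eq0 (negPf mP) /= => /eqP/val_inj rmq.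
congr pair => //; apply/matrixP => a b.
case ab: ((a == m) && (b == q)); last exact: rr'.
by case/andP: ab => /eqP -> /eqP ->.
Qed.

(** Two nested union bounds, over ordered pairs of distinct indices and then over [z], reduce to a
    single column relation. *)
Lemma card_power_relation (K : fieldType) (n e : nat) (S : {fset K})
    (A : 'M[K]_n) (p q : 'I_n) (E : pred 'M[S]_n) :
  A \in unitmx -> p != q -> (0 < e)%N ->
  (forall r, E r -> let B := A *m map_mx val r in
     (forall i, B i p != 0) /\
     exists i j, i != j /\ (B i q * B j p) ^+ e = (B j q * B i p) ^+ e) ->
  (#|E| * #|{: S}| <= n * n.-1 * e * #|{: 'M[S]_n}|)%N.
Proof.
move=> uA pq e0 EP; pose B (r : 'M[S]_n) := A *m map_mx val r.
have [s szs sE] := eq_expr_seq K e0.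
pose pairs := enum [pred x : 'I_n * 'I_n | x.2 != x.1].
have sz_pairs : size pairs = (n * n.-1)%N.
  rewrite -cardE -sum1_card.
  rewrite -(pair_big_dep xpredT (fun i j => j != i) (fun _ _ => 1%N)) /=.
  under eq_bigr => i _ do rewrite sum1_card cardC1 card_ord.
  by rewrite sum_nat_const card_ord.
rewrite -mulnA -sz_pairs.
pose F (x : 'I_n * 'I_n) : pred 'M[S]_n := fun r => (B r x.2 p != 0) &&
  ((B r x.1 q * B r x.2 p) ^+ e == (B r x.2 q * B r x.1 p) ^+ e).
apply: (card_union_bound (F := F)) => [r /EP/=[B0 [i [j [ij BE]]]] | [i j]].
  by exists (i, j); rewrite ?mem_enum ?inE 1?eq_sym //= /F B0; apply/eqP.
rewrite mem_enum inE eq_sym => /= ij.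
apply: leq_trans (leq_mul szs (leqnn _)).
pose G z : pred 'M[S]_n := fun r =>
  (B r j p != 0) && (B r j p * B r i q == z * (B r i p * B r j q)).
apply: (card_union_bound (F := G)) => [r /andP[/= B0 /eqP/sE[z sz zE]] | z _].
  by exists z => //; rewrite /G B0 mulrC zE [B r j q * _]mulrC /=.
by apply: (card_column_relation (z := z) uA ij pq) => r /andP[B0 /eqP].
Qed.

(** * The probability bound *)

Theorem theorem5p1 (R : realType) (k : scalar_kind) (n d : nat)
    (hn : (2 <= n)%N) (hd : (3 <= d)%N)
    (P f : {mpoly (scalars R k)[n]}) (A : 'M[scalars R k]_n)
    (hP : power_forms d P) (hA : A \in unitmx) (hf : f = linear_subst P A)
    (S : {fset scalars R k}) (hS : S != fset0)
    (T : 'M[scalars R k]_n -> tensor (scalars R k) n d)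
    (hT : forall M : 'M[scalars R k]_n, is_tensor_of (linear_subst f M) (T M)) :
  let T1 M := diag_slice (ltnW hd) (T M) (Ordinal (ltnW hn)) in
  let T2 M := diag_slice (ltnW hd) (T M) (Ordinal hn) in
  Pr_unif R S (fun M =>
      repeated_eigenvalue (invmx (T1 M) *m T2 M) /\ T1 M \in unitmx)
    <= (2 * 'C(n, 2) * (d - 2))%:R / #|` S|%:R.
Proof.
cbv zeta; case: hP => alpha alpha0 PE.
set p := Ordinal (ltnW hn); set q := Ordinal hn; set e := (d - 2)%N.
have e0 : (0 < e)%N by rewrite subn_gt0.
have pq : p != q by [].
(* [T M] is any symmetric tensor of the form; by uniqueness it is the power tensor of [A *m M]. *)
have sliceE M m : diag_slice (ltnW hd) (T M) m =
    (A *m M)^T *m diag_mx (\row_i (alpha i * (A *m M) i m ^+ e)) *m (A *m M).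
  rewrite -(diag_slice_power_tensor (ltnW hd)); apply/matrixP => i j; rewrite !mxE.
  have [symT TE] := hT M.
  apply: symmetric_tensor_uniq (scalars_char0 R k) symT _ _ _.
    exact: power_tensor_sym.
  by rewrite -TE hf linear_substM PE linear_subst_power_sum.
have S0 : (0 < #|{: S}|)%N by rewrite -cardfE cardfs_gt0.
rewrite /Pr_unif sumr_const; set E := (X in #|X|).
(* All outcomes weigh the same, so the probability is a ratio of cardinals. *)
have -> : \prod_(i < n) \prod_(j < n) #|` S|%:R^-1 = #|{: 'M[S]_n}|%:R^-1 :> R.
  by rewrite !prodr_const !card_ord -!exprM card_mx natrX exprVn cardfE.
rewrite -[_^-1 *+ _]mulr_natl ler_pdivrMr; last by rewrite ltr0n card_mx expn_gt0 S0.
rewrite mulrAC ler_pdivlMr ?cardfE ?ltr0n // -!natrM ler_nat.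
have -> : (2 * 'C(n, 2) = n * n.-1)%N.
  by rewrite mulnC (bin_ffact n 2) ffactnS ffactn1.
apply: (card_power_relation hA pq e0) => r /asboolP[].
rewrite !sliceE => rep /pencil_repeated_eigenvalue/(_ rep)[d1 [i [j [ij dE]]]].
split=> [l | ].
  by have := d1 l; rewrite mxE mulf_eq0 expf_eq0 e0 negb_or => /andP[].
exists i, j; split=> //; move: dE; rewrite !mxE => dE.
(* The nonzero factor [alpha i * alpha j] occurs on both sides of [dE] and cancels. *)
apply: (mulfI (mulf_neq0 (alpha0 i) (alpha0 j))).
by rewrite !exprMn mulrACA dE [alpha i * alpha j in RHS]mulrC [RHS]mulrACA.
Qed.
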